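(* There exist constants $C$ and $n_0$ such that the following holds for every $n \ge n_0$. Let $G$ be a cubic graph on $n$ vertices. Then the edges of $G$ can be red-blue coloured so that all monochromatic components are paths of length at most $C\log n$, and, for every $t \ge 1$, the number of red components which are paths of length $t$ and the number of blue components which are paths of length $t$ differ by at most $n^{2/3}$.
   Context: Graphs are finite and simple; a cubic graph is a $3$-regular graph ($G$ need not be connected, and $n$ need not be divisible by $4$). The length of a path is its number of edges, and $\log$ is the natural logarithm. A red (blue) component is a connected component of the graph formed by the red (blue) edges; a monochromatic component is a red or a blue component. *)

(* Defs.v *)
From mathcomp Require Import all_boot.

Set Implicit Arguments.
Unset Strict Implicit.
Unset Printing Implicit Defensive.

(* A finite simple graph is a symmetric irreflexive relation on a finType. *)
Definition cubic (T : finType) (e : rel T) : Prop :=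
  forall x : T, #|[set y | e x y]| = 3.

(* A red-blue colouring assigns a colour to each unordered pair {x, y}; only
   the values on edges are ever used. *)
Definition red : bool := true.
Definition blue : bool := false.

Definition colour_graph (T : finType) (e : rel T) (c : {set T} -> bool)
    (b : bool) : rel T :=
  [rel x y | e x y && (c [set x; y] == b)].

(* Vertex sets of the connected components of the spanning graph (T, r),
   for r symmetric; an isolated vertex is a component by itself. *)
Definition components (T : finType) (r : rel T) : {set {set T}} :=
  equivalence_partition (connect r) [set: T].

Definition path_graph (t : nat) : rel 'I_t.+1 :=
  [rel i j : 'I_t.+1 | (i.+1 == j :> nat) || (j.+1 == i :> nat)].

(* The subgraph of r induced on S is isomorphic to the path with t edges. *)
Definition is_path_of_length (T : finType) (r : rel T) (t : nat)
    (S : {set T}) : bool :=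
  [exists f : {ffun 'I_t.+1 -> T},
    [&& injectiveb f, S == f @: [set: 'I_t.+1]
      & [forall i, forall j, r (f i) (f j) == path_graph i j]]].

Definition num_path_components (T : finType) (r : rel T) (t : nat) : nat :=
  #|[set S in components r | is_path_of_length r t S]|.

(* Main.v *)
(** Give every vertex v one neighbour s(v), such that s(s(v)) <> v, each
    component of G contains a single directed s-cycle, and no two vertices
    outside the image of s are adjacent (take such an s with the total size of
    its orbits maximal: if leaves v, w are adjacent, redirecting s(v) to w
    makes an orbit longer).  Requiring the two edges at v other than {v, s(v)}
    to have different colours makes every colour class have maximum degree 2,
    and these requirements split E(G) into trails with at most four edges, each
    to be coloured alternately.  A path or cycle with all edges of one colour
    must follow s once it uses an edge {v, s(v)}.  Hence a monochromatic cycle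
    is an s-cycle, which is ruled out by tying together two trails per
    component of G, and a long monochromatic path contains a long
    monochromatic s-chain.

    Colour the trails (up to the ties) by independent fair bits.  An s-chain
    with 4q vertices meets at least q bits, so it is monochromatic with
    probability at most 2^(1-q): all monochromatic paths have length O(log n).
    Swapping the colours shows that the difference X_t of the numbers of red
    and blue paths of length t has mean 0, and one bit changes X_t by at most
    32, so E X_t^2 <= 256 n.  Chebyshev's inequality for the O(log n) relevant
    values of t concludes. *)

Require Import Defs.
From mathcomp Require Import all_boot all_order all_algebra.
From mathcomp Require Import zify ring lra.

Set Implicit Arguments.
Unset Strict Implicit.
Unset Printing Implicit Defensive.

Import Order.TTheory GRing.Theory Num.Theory.

(** * Paths and cycles *)

Section MaximalPaths.
Variables (T : finType) (r : rel T).
Hypothesis r_sym : symmetric r.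

(** A path that can be prolonged at an end is prolonged there; this stops because a path has at most
    [#|T|] vertices. *)
Lemma exists_maximal_path (x0 : T) : exists (y : T) (q : seq T),
  [/\ path r y q, uniq (y :: q), x0 \in y :: q,
      forall z, r z y -> z \in y :: q & forall z, r (last y q) z -> z \in y :: q].
Proof.
suff grow k : exists (y : T) (q : seq T), [/\ path r y q, uniq (y :: q), x0 \in y :: q &
    k < size (y :: q) \/ ((forall z, r z y -> z \in y :: q) /\
                          (forall z, r (last y q) z -> z \in y :: q))].
  have [y [q [yq uq x0q [big|[hy hq]]]]] := grow #|T|; last by exists y, q.
  by have := max_card (mem (y :: q)); rewrite (card_uniqP uq) leqNgt big.
elim: k => [|k [y [q [yq uq x0q [big|mx]]]]]; first by
    exists x0, [::]; rewrite mem_head; split => //; left.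
  have [/existsP[z /andP[rzy zq]]|] := boolP [exists z, r z y && (z \notin y :: q)].
    exists z, (y :: q); split.
    - by rewrite /= rzy.
    - by rewrite cons_uniq zq.
    - by rewrite in_cons x0q orbT.
    - by left; rewrite ltnS.
  move=> /existsPn hy.
  have [/existsP[z /andP[rzy zq]]|] := boolP [exists z, r (last y q) z && (z \notin y :: q)].
    exists y, (rcons q z); split.
    - by rewrite rcons_path yq.
    - by rewrite -rcons_cons rcons_uniq zq.
    - by rewrite -rcons_cons mem_rcons inE x0q orbT.
    - by left; rewrite -rcons_cons size_rcons ltnS.
  move=> /existsPn hq; exists y, q; split => //; right; split => z rz.
    by have := hy z; rewrite rz /= negbK.
  by have := hq z; rewrite rz /= negbK.
by exists y, q; split => //; right.
Qed.

Lemma sorted_nth_rel (x0 : T) (p : seq T) (i : nat) :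
  sorted r p -> i.+1 < size p -> r (nth x0 p i) (nth x0 p i.+1).
Proof. by case: p => // y q /= yq; rewrite ltnS => /(pathP x0 yq). Qed.

Lemma chord_cycle (x0 : T) (p : seq T) (i j : nat) :
  sorted r p -> uniq p -> i.+1 < j -> j < size p -> r (nth x0 p i) (nth x0 p j) ->
  exists c : seq T, [/\ cycle r c, uniq c, 2 < size c & {subset c <= p}].
Proof.
move=> sp up ij jp rij; exists (drop i (take j.+1 p)).
have sz : size (take j.+1 p) = j.+1 by rewrite size_takel.
have sd : size (drop i (take j.+1 p)) = (j - i).+1 by rewrite size_drop sz subSn // ltnW // ltnW.
split; last 1 first.
- by move=> x /mem_drop /mem_take.
- rewrite (drop_nth x0) ?sz; last by lia.
  rewrite nth_take; last by lia.
  rewrite /= rcons_path; apply/andP; split.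
    have := drop_sorted i (take_sorted j.+1 sp); rewrite (drop_nth x0) ?sz; last by lia.
    by rewrite nth_take //; lia.
  rewrite (last_nth x0) size_drop sz subSS.
  have -> : j - i = (j - i.+1).+1 by lia.
  rewrite /= nth_drop nth_take; last by lia.
  have -> : i.+1 + (j - i.+1) = j by lia.
  by rewrite r_sym.
- by rewrite drop_uniq // take_uniq.
- by rewrite sd; lia.
Qed.

(** Both given neighbours of the first vertex of a maximal path lie on that path, and one of them is
    not its second vertex, which makes a chord. *)
Lemma exists_cycle (A : {pred T}) (x0 : T) : closed r A -> x0 \in A ->
  (forall x, exists y z, [/\ r x y, r x z, y != z, y != x & z != x]) ->
  exists c : seq T, [/\ cycle r c, uniq c, 2 < size c & {subset c <= A}].
Proof.
move=> clA Ax0 deg2; have [y [q [yq uq x0q hy _]]] := exists_maximal_path x0.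
have [a [b [rya ryb ab ay by_]]] := deg2 y.
have yA : {subset y :: q <= A}.
  have subA u v : path r u v -> u \in A -> {subset u :: v <= A}.
    elim: v u => [|w v IH] u /=; first by move=> _ Au t; rewrite inE => /eqP ->.
    move=> /andP[ruw wv] Au t; rewrite inE => /orP[/eqP -> //|].
    by apply: IH => //; rewrite -(clA _ _ ruw).
  apply: subA => //; case/splitPl: x0q yq => q1 q2 lq; rewrite cat_path lq => /andP[yq1 _].
  have con : connect r y x0 by apply/connectP; exists q1.
  by rewrite (closed_connect clA con).
suff [z [ryz zy i1]] : exists z, [/\ r y z, z \in q & 0 < index z q].
  have [|||c [h1 h2 h3 h4]] := @chord_cycle y (y :: q) 0 (index z q).+1 yq uq => //.
  - by rewrite ltnS index_mem.
  - by rewrite /= nth_index.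
  by exists c; split => // t /h4 /yA.
have aq : a \in q by have := hy a; rewrite r_sym rya inE (negPf ay) => /(_ isT).
have bq : b \in q by have := hy b; rewrite r_sym ryb inE (negPf by_) => /(_ isT).
have [ia|ia] := posnP (index a q); last by exists a.
have [ib|ib] := posnP (index b q); last by exists b.
by move: ab; rewrite -(nth_index a aq) -(nth_index a bq) ia ib eqxx.
Qed.

Hypothesis deg2 : forall x y1 y2 y3,
  uniq [:: y1; y2; y3] -> r x y1 -> r x y2 -> r x y3 -> False.
Hypothesis acyclic : forall c, cycle r c -> uniq c -> size c <= 2.
Hypothesis r_irr : irreflexive r.

(** A maximal path has no chord by acyclicity, and no edge leaves it: inner vertices have used up
    their degree, and the ends are blocked by maximality. So it fills the component. *)
Lemma component_is_path (S : {set T}) : S \in components r ->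
  exists l, is_path_of_length r l S.
Proof.
move=> /imsetP[x _ ->].
have [y [q [yq uq xq hy hq]]] := exists_maximal_path x.
set p := y :: q in uq xq hy hq.
have nthp i (ip : i < size p) : nth y p i \in p by rewrite mem_nth.
have far i j : i < j -> j < size p -> r (nth y p i) (nth y p j) = (i.+1 == j).
  move=> ij jp; have [ej|ne] := eqVneq.
    by move: jp; rewrite -ej => jp; apply: sorted_nth_rel.
  apply/negbTE/negP => rij.
  have [|c [c1 c2 c3 _]] := @chord_cycle y p i j yq uq _ jp rij; first by rewrite ltn_neqAle ne.
  by move: c3; rewrite ltnNge acyclic.
have clp u v : r u v -> u \in p -> v \in p.
  move=> ruv up; apply: contraT => vp.
  suff: v \in p by rewrite (negPf vp).
  set i := index u p; have ip : i < size p by rewrite index_mem.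
  have ui : nth y p i = u by rewrite nth_index.
  have [i0|i0] := posnP i.
    by apply: hy; rewrite r_sym; move: ruv; rewrite -ui i0.
  have [il|il] := eqVneq i.+1 (size p).
    by apply: hq; rewrite (last_nth y); move: ruv; rewrite -ui; case: il => ->.
  have ip1 : i.+1 < size p by rewrite ltn_neqAle il.
  case: (@deg2 u (nth y p i.-1) (nth y p i.+1) v _ _ _ ruv).
  - have ne w : w < size p -> nth y p w != v.
      by move=> wp; apply: contraNneq vp => <-; exact: nthp.
    have ip' : i.-1 < size p := leq_ltn_trans (leq_pred i) ip.
    rewrite !cons_uniq !inE !negb_or !ne ?nth_uniq ?andbT //.
    by case: (i) i0 => [|k] // _; rewrite neq_ltn ltnW.
  - by rewrite r_sym -ui far ?prednK.
  - by rewrite -ui far.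
have Sp : [set z in setT | connect r x z] = [set z in p].
  apply/setP => z; rewrite !inE -[LHS]/(connect r x z); apply/idP/idP.
    move=> /connectP[s]; elim: s x xq => [|w s IH] u up /=; first by move=> _ ->.
    by move=> /andP[ruw ws]; apply: IH ws; apply: clp up.
  have cy w : w \in p -> connect r y w.
    move=> wp; case/splitPl: wp yq => q1 q2 lq; rewrite cat_path => /andP[yq1 _].
    by apply/connectP; exists q1.
  move=> zp; apply: connect_trans (cy _ zp); rewrite sym_connect_sym //; exact: cy.
exists (size q); apply/existsP; exists [ffun i : 'I_(size q).+1 => nth y p i].
apply/and3P; split.
- by apply/injectiveP => i j; rewrite !ffunE => /eqP; rewrite nth_uniq // => /eqP /val_inj.
- rewrite Sp; apply/eqP/setP => z; rewrite inE.
  apply/idP/imsetP => [zp|[i _ ->]]; last by rewrite ffunE nthp.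
  have iz : index z p < (size q).+1 by rewrite -[(size q).+1]/(size p) index_mem.
  by exists (Ordinal iz) => //; rewrite ffunE /= nth_index.
- apply/forallP => i; apply/forallP => j; rewrite !ffunE /path_graph /=.
  have [ij|ij|ij] := ltngtP i j.
  + by rewrite far //; apply/eqP; lia.
  + by rewrite r_sym far //; apply/eqP; lia.
  + by rewrite ij r_irr; apply/eqP; lia.
Qed.

End MaximalPaths.

(** * Path counts under local changes *)

Section Perturbation.
Variables (T : finType) (r r' : rel T).
Hypothesis r_sym : symmetric r.

Lemma connect_equiv (q : rel T) : symmetric q -> {in setT & &, equivalence_rel (connect q)}.
Proof.
move=> qs x y z _ _ _; split; first exact: connect0.
by move=> xy; rewrite (same_connect (sym_connect_sym qs) xy).
Qed.

Lemma component_agree (U : {set T}) (S : {set T}) :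
  (forall x y, x \notin U -> r x y = r' x y) -> [disjoint S & U] ->
  S \in components r -> S \in components r'.
Proof.
move=> agree SU /imsetP[x _ Sx]; apply/imsetP; exists x => //; rewrite Sx.
have Sc z : (z \in S) = connect r x z by rewrite Sx !inE.
have nU z : connect r x z -> z \notin U.
  by rewrite -Sc => zS; have /pred0P/(_ z) := SU; rewrite /= zS /= => ->.
apply/setP => z; rewrite !inE -[LHS]/(connect r x z) -[RHS]/(connect r' x z).
apply/idP/idP => /connectP[s xs ->].
  elim/last_ind: s xs => [|s w IH]; first by rewrite connect0.
  rewrite rcons_path last_rcons => /andP[xs rw]; apply: connect_trans (IH xs) (connect1 _).
  by rewrite -agree // nU //; apply/connectP; exists s.
elim/last_ind: s xs => [|s w IH]; first by rewrite connect0.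
rewrite rcons_path last_rcons => /andP[xs rw]; apply: connect_trans (IH xs) (connect1 _).
by rewrite agree // nU // IH.
Qed.

Lemma path_component_agree (U : {set T}) (S : {set T}) (t : nat) :
  (forall x y, x \notin U -> r x y = r' x y) -> [disjoint S & U] ->
  is_path_of_length r t S -> is_path_of_length r' t S.
Proof.
move=> agree SU /existsP[f /and3P[fi /eqP Sf /forallP h]]; apply/existsP; exists f.
rewrite fi {1}Sf eqxx /=; apply/forallP => i; apply/forallP => j.
have /forallP/(_ j) := h i; rewrite agree //.
by have /pred0P/(_ (f i)) := SU; rewrite /= Sf imset_f ?inE //= => ->.
Qed.

Lemma card_components_meeting (U : {set T}) :
  #|[set S in components r | ~~ [disjoint S & U]]| <= #|U|.
Proof.
have /and3P[_ tI _] := equivalence_partitionP (connect_equiv r_sym).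
apply: leq_trans _ (leq_imset_card (pblock (components r)) U).
apply/subset_leq_card/subsetP => S; rewrite inE => /andP[CS /pred0Pn[x /= /andP[xS xU]]].
by apply/imsetP; exists x => //; rewrite (def_pblock tI CS).
Qed.

(** Path components that avoid U survive unchanged, and at most [#|U|] components meet U. *)
Lemma num_path_components_perturb (U : {set T}) (t : nat) :
  (forall x y, x \notin U -> r x y = r' x y) ->
  num_path_components r t <= num_path_components r' t + #|U|.
Proof.
move=> agree; apply: leq_trans (leq_add (leqnn _) (card_components_meeting U)).
rewrite /num_path_components -cardsUI; apply: leq_trans (leq_addr _ _).
apply/subset_leq_card/subsetP => S; rewrite !inE => /andP[CS PS].
have [SU|//] := boolP [disjoint S & U]; last by rewrite CS orbT.
by rewrite (component_agree agree) // (path_component_agree agree).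
Qed.

End Perturbation.

(** * Unicyclic orientations *)

Lemma next_next_neq (T : eqType) (c : seq T) (x : T) :
  uniq c -> 2 < size c -> x \in c -> next c (next c x) != x.
Proof.
move=> uc c3 xc; have [i q rq] := rot_to xc; rewrite -!(next_rot i uc) rq.
have : uniq (rot i c) by rewrite rot_uniq.
have : 2 < size (rot i c) by rewrite size_rot.
rewrite rq; case: q {rq} => [|a [|b q]] //= _; rewrite !inE !negb_or eqxx.
move=> /and3P[/and3P[xa xb _] _ _].
by rewrite [a == x]eq_sym (negPf xa) eqxx eq_sym.
Qed.

Section CubicNeighbours.
Variables (T : finType) (e : rel T).
Hypothesis e_cubic : cubic e.

Lemma cubic_four_neighbours (x a b c d : T) :
  e x a -> e x b -> e x c -> e x d -> ~~ uniq [:: a; b; c; d].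
Proof.
move=> xa xb xc xd; apply/negP => u.
have : #|[:: a; b; c; d]| <= #|[set y | e x y]|.
  by apply/subset_leq_card/subsetP => z; rewrite !inE => /or4P[] /eqP ->.
by rewrite e_cubic (card_uniqP u).
Qed.

Lemma cubic_two_neighbours (x y : T) :
  exists a b, [/\ e x a, e x b, a != b, a != y & b != y].
Proof.
have : 1 < #|[set z | e x z] :\ y|.
  have := cardsD1 y [set z | e x z]; rewrite e_cubic; case: (y \in _); lia.
move=> /card_gt1P[a [b [+ + ab]]]; rewrite !inE => /andP[ay xa] /andP[by_ xb].
by exists a, b.
Qed.

End CubicNeighbours.

Lemma fconnect_agree (T : finType) (s s' : T -> T) (D : {pred T}) (x z : T) :
  (forall y, y \in D -> s y \in D) -> (forall y, y \in D -> s' y = s y) ->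
  x \in D -> fconnect s x z -> fconnect s' x z /\ z \in D.
Proof.
move=> clD agree Dx /iter_findex <-; elim: (findex _ _ _) => [|n [IH IHD]] /=.
  by rewrite connect0.
split; last exact: clD.
by apply: connect_trans IH _; apply: connect1; rewrite /= agree.
Qed.

Section Flow.
Variables (T : finType) (e : rel T).
Hypotheses (e_sym : symmetric e) (e_irr : irreflexive e) (e_cubic : cubic e).

(* The second clause says that each component of G inside D has only one s-cycle. *)
Definition flow_on (D : {pred T}) (s : T -> T) : Prop :=
  (forall x, x \in D -> [/\ s x \in D, e x (s x) & s (s x) != x]) /\
  (forall x y, x \in D -> y \in D -> connect e x y ->
     exists z, fconnect s x z /\ fconnect s y z).

(** Nothing in D maps to v, so the orbits in D stay as they were, and the orbit of v runs into that
    of w. *)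
Lemma flow_on_extend (D : {set T}) (s : T -> T) (v w : T) :
  flow_on D s -> v \notin D -> w \in D -> e v w ->
  flow_on (v |: D) [fun x => s x with v |-> w].
Proof.
move=> [Ds Dc] vD wD evw; set s' := [fun x => s x with v |-> w].
have nev y : y \in D -> y != v by apply: contraTneq => ->.
have s'D y : y \in D -> s' y = s y by move=> /nev yv; rewrite /= (negPf yv).
have s'v : s' v = w by rewrite /= eqxx.
have clD y : y \in D -> s y \in D by case/Ds.
have con y z : y \in D -> fconnect s y z -> fconnect s' y z.
  by move=> yD /(fconnect_agree clD s'D yD) [].
have cvw : fconnect s' v w by rewrite -[X in fconnect _ _ X]s'v fconnect1.
split.
  move=> x; rewrite !inE => /orP[/eqP ->|xD]; last first.
    by have [sD es ss] := Ds _ xD; rewrite s'D // s'D // sD orbT.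
  by rewrite s'v wD orbT evw s'D // nev // clD.
have vw y : connect e v y = connect e w y.
  by apply: same_connect; [exact: sym_connect_sym | exact: connect1].
move=> x y; rewrite !inE => /orP[/eqP ->|xD] /orP[/eqP ->|yD].
- by exists v; rewrite connect0.
- rewrite vw => /(Dc _ _ wD yD) [z [wz yz]]; exists z; split; last exact: con.
  by apply: connect_trans cvw _; exact: con.
- rewrite sym_connect_sym // vw => /(Dc _ _ wD xD) [z [wz yz]]; exists z; split; first exact: con.
  by apply: connect_trans cvw _; exact: con.
- by move=> /(Dc _ _ xD yD) [z [xz yz]]; exists z; split; exact: con.
Qed.

(** Closedness of D puts the new cycle into a component of G that D does not meet, so its orbit need
    not meet any orbit in D. *)
Lemma flow_on_add_cycle (D : {set T}) (s : T -> T) (c : seq T) :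
  flow_on D s -> closed e (mem D) -> cycle e c -> uniq c -> 2 < size c ->
  (forall x, x \in c -> x \notin D) ->
  flow_on (D :|: [set x in c]) (fun x => if x \in c then next c x else s x).
Proof.
move=> [Ds Dc] clD ec uc c3 cD; set s' : T -> T := fun x => if x \in c then _ else _.
have s'D y : y \in D -> s' y = s y by rewrite /s'; case: ifP => // /cD /negPf ->.
have con y z : y \in D -> fconnect s y z -> fconnect s' y z.
  by move=> yD /(fconnect_agree (fun y yD => let: And3 h _ _ := Ds y yD in h) s'D yD) [].
have s'c y : y \in c -> s' y = next c y by rewrite /s' => ->.
have fc : fcycle s' c by apply: cycle_from_next => // x xc; rewrite /= s'c.
split.
  move=> x; rewrite !inE => /orP[xD|xc].
    by have [sD es ss] := Ds _ xD; rewrite s'D // s'D // sD es ss.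
  rewrite s'c // mem_next xc orbT s'c ?mem_next //; split => //; first exact: next_cycle.
  exact: next_next_neq.
move=> x y; rewrite !inE => /orP[xD|xc] /orP[yD|yc].
- by move=> /(Dc _ _ xD yD) [z [xz yz]]; exists z; split; exact: con.
- by move=> /(closed_connect clD); rewrite xD (negPf (cD _ yc)).
- by move=> /(closed_connect clD); rewrite yD (negPf (cD _ xc)).
- by move=> _; exists x; rewrite connect0 (fconnect_cycle fc yc) xc.
Qed.

Lemma exists_flow : exists s, flow_on T s.
Proof.
suff grow k : exists (D : {set T}) s, flow_on D s /\ (D = setT \/ k <= #|D|).
  have [D [s [[h1 h2] DT]]] := grow #|T|.
  have {}DT : D = setT.
    by case: DT => // DT; apply/eqP; rewrite eqEcard subsetT cardsT.
  rewrite DT in h1 h2; exists s; split => [x _|x y _ _]; last exact: h2.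
  by have [] := h1 x; rewrite ?inE.
elim: k => [|k [D [s [fD Dk]]]].
  by exists set0, id; split; [split => x; rewrite inE | right].
have [DT|/eqP DT] := D =P setT; first by exists D, s; split => //; left.
have {}Dk : k <= #|D| by case: Dk => // /eqP; rewrite (negPf DT).
(* If an edge leaves D, its outer end is attached; otherwise D is a union of components and a cycle
   is found outside it. *)
have [/existsP[v /existsP[w /and3P[vD wD evw]]]|/existsPn noedge] :=
  boolP [exists v, exists w, [&& v \notin D, w \in D & e v w]].
  exists (v |: D), [fun x => s x with v |-> w]; split; first exact: flow_on_extend.
  by right; rewrite cardsU1 vD.
have clD : closed e (mem D).
  apply: intro_closed => [|x y exy xD]; first exact: sym_connect_sym.
  have /existsPn/(_ x) := noedge y; rewrite /= e_sym exy xD !andbT negbK.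
  by [].
have [v vD] : exists v, v \notin D.
  apply/existsP; apply: contraR DT => /existsPn h; apply/eqP/setP => x.
  by have := h x; rewrite inE negbK.
have [|||c [ec uc c3 cD]] := @exists_cycle T e e_sym (mem (~: D)) v.
- by move=> x y exy; have := clD x y exy; rewrite !inE => ->.
- by rewrite !inE.
- move=> x; have [a [b [xa xb ab ax bx]]] := cubic_two_neighbours e_cubic x x.
  by exists a, b.
exists (D :|: [set x in c]), (fun x => if x \in c then next c x else s x); split.
  by apply: flow_on_add_cycle => // x /cD; rewrite !inE.
right; apply: leq_ltn_trans Dk _; apply: proper_card; apply/properP; split; first exact: subsetUl.
case: c c3 cD {ec uc} => // x c _ /(_ x); rewrite mem_head => /(_ isT); rewrite inE => xD.
by exists x; rewrite // !inE eqxx orbT.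
Qed.

Definition no_adjacent_leaves (s : T -> T) : Prop :=
  forall v w, e v w -> (exists u, s u = v) \/ (exists u, s u = w).

(** Only the orbit of v passes through v, so the other orbits do not shrink when v is sent to w. The
    new orbit of v contains v and the orbit of w, hence is larger than the old one. *)
Lemma reparent_leaf (s : T -> T) (v w : T) :
  flow_on T s -> e v w -> (forall u, s u != v) -> (forall u, s u != w) ->
  #|fconnect s v| <= #|fconnect s w| ->
  exists s', flow_on T s' /\ \sum_x #|fconnect s x| < \sum_x #|fconnect s' x|.
Proof.
move=> [s1 s2] evw vleaf wleaf le_vw.
(* The leaf v is detached, which leaves a flow as nothing maps to v, and then attached to w. *)
have fD : flow_on (~: [set v]) s.
  split=> [x _|x y _ _]; last exact: s2.
  by have [_ ex sx] := s1 x isT; rewrite !inE vleaf.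
have wv : w != v by apply: contraTneq evw => ->; rewrite e_irr.
have [||//|f1 f2] := @flow_on_extend (~: [set v]) s v w fD; rewrite ?inE ?eqxx //.
set s' := [fun x => s x with v |-> w] in f1 f2 *; exists s'; split.
  have inT x : x \in v |: ~: [set v] by rewrite !inE orbN.
  by split=> [x _|x y _ _]; [have [] := f1 x (inT x) | apply: f2].
have sub x : x != v -> {subset fconnect s x <= fconnect s' x}.
  move=> xv z xz; have [||||//] := @fconnect_agree _ s s' (mem (~: [set v])) x z.
  - by move=> y _; rewrite !inE vleaf.
  - by move=> y; rewrite !inE => /negPf /= ->.
  - by rewrite !inE.
  - exact: xz.
rewrite (bigD1 v) //= [X in _ < X](bigD1 v) //= -addSn; apply: leq_add; last first.
  by apply: leq_sum => x xv; apply/subset_leq_card/subsetP/sub.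
apply: leq_ltn_trans le_vw _; apply: proper_card; apply/properP; split.
  apply/subsetP => z /(sub _ wv); apply: connect_trans.
  by have := fconnect1 s' v; rewrite [s' v]/= eqxx.
exists v; first exact: connect0.
apply/negP => /iter_findex; case: (findex _ _ _) => [/=|n /= h]; first exact/eqP.
by have := vleaf (iter n s w); rewrite h eqxx.
Qed.

Lemma exists_leaf_sparse_flow : exists s, flow_on T s /\ no_adjacent_leaves s.
Proof.
(* The total size of the orbits is bounded, so the redirections of leaves come to an end. *)
suff grow k : exists s, flow_on T s /\ (no_adjacent_leaves s \/ k <= \sum_x #|fconnect s x|).
  have [s [fs [|]]] := grow (\sum_(x : T) #|T|).+1; first by exists s.
  by rewrite ltnNge leq_sum // => x _; exact: max_card.
elim: k => [|k [s [fs [ns|sk]]]]; first by have [s fs] := exists_flow; exists s; split=> //; right.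
  by exists s; split => //; left.
have [/forallP h|] := boolP [forall v, forall w,
    e v w ==> [exists u, s u == v] || [exists u, s u == w]].
  exists s; split=> //; left=> v w evw.
  by have /forallP/(_ w) := h v; rewrite evw => /orP[] /existsP[u /eqP <-]; [left|right]; exists u.
move=> /forallPn[v /forallPn[w]]; rewrite negb_imply negb_or.
move=> /and3P[evw /existsPn vl /existsPn wl].
have [le|/ltnW le] := leqP #|fconnect s v| #|fconnect s w|.
  have [s' [fs' lt]] := reparent_leaf fs evw vl wl le.
  by exists s'; split => //; right; apply: leq_ltn_trans lt.
rewrite e_sym in evw; have [s' [fs' lt]] := reparent_leaf fs evw wl vl le.
by exists s'; split => //; right; apply: leq_ltn_trans lt.
Qed.

End Flow.

(** * Alternating trails *)

Section Trails.
Variables (T : finType) (e : rel T) (s : T -> T).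
Hypotheses (e_sym : symmetric e) (e_irr : irreflexive e) (e_cubic : cubic e).
Hypothesis s_edge : forall x, e x (s x).
Hypothesis s_s : forall x, s (s x) != x.

(** These edges lie outside the functional graph of s; they are the inner edges of the trails. *)
Definition cross (x y : T) : bool := [&& e x y, s x != y & s y != x].
Definition leaf (l : T) : bool := [forall u, s u != l].

(* [linked a b] says that the edges {a, s a} and {b, s b} are the two ends of one
   trail; the three cases are trails with 2, 3 and 4 edges, so the ends have equal
   colours exactly when [cross (s a) (s b)]. *)
Definition linked1 (a b : T) : bool := (a != b) && (s a == s b).
Definition linked2 (a b : T) : bool := cross (s a) (s b).
Definition linked3 (a b : T) : bool :=
  (s a != s b) && [exists l, [&& leaf l, cross (s a) l & cross (s b) l]].
Definition linked (a b : T) : bool := [|| linked1 a b, linked2 a b | linked3 a b].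

Lemma cross_sym : symmetric cross.
Proof. by move=> x y; rewrite /cross e_sym [(s x != y) && _]andbC. Qed.

Lemma linked_sym : symmetric linked.
Proof.
move=> a b; rewrite /linked; congr [|| _, _ | _].
- by rewrite /linked1 eq_sym [s a == _]eq_sym.
- exact: cross_sym.
- rewrite /linked3 eq_sym; congr (_ && _); apply: eq_existsb => l.
  by rewrite [cross (s a) l && _]andbC.
Qed.

Lemma leaf_neq (l u : T) : leaf l -> s u != l.
Proof. by move/forallP. Qed.

Lemma third_neighbour (x u v w : T) : e x u -> u != s x ->
  e x v -> v != s x -> v != u -> e x w -> w != s x -> w != u -> v = w.
Proof.
move=> xu us xv vs vu xw ws wu; apply/eqP/negPn/negP => vw.
have := cubic_four_neighbours e_cubic (s_edge x) xu xv xw.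
rewrite /= !inE !negb_or ![s x == _]eq_sym us vs ws.
by rewrite [u == v]eq_sym [u == w]eq_sym vu wu vw.
Qed.

(* The neighbour of [s a] at which the trail starting with the edge {a, s a} goes on. *)
Definition slot (a v : T) : bool := [&& e (s a) v, v != s (s a) & v != a].

Lemma s_edge_rev (a : T) : e (s a) a.
Proof. by rewrite e_sym s_edge. Qed.

Lemma slot_uniq (a v w : T) : slot a v -> slot a w -> v = w.
Proof.
move=> /and3P[av vs va] /and3P[aw ws wa].
by apply: (@third_neighbour (s a) a v w); rewrite ?s_edge_rev // eq_sym s_s.
Qed.

Lemma slot1 (a b : T) : linked1 a b -> slot a b.
Proof.
move=> /andP[ab /eqP sab]; apply/and3P; rewrite sab s_edge_rev; split => //; last by rewrite eq_sym.
by rewrite eq_sym s_s.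
Qed.

Lemma slot_cross (a v : T) : cross (s a) v -> slot a v.
Proof.
move=> /and3P[ev v1 v2]; apply/and3P; split; rewrite // 1?eq_sym //.
by apply: contraNneq v2 => ->.
Qed.

(** The trail leaves [s a] towards a single vertex, and a leaf is not of the form [s b]. *)
Lemma linked3_cross (a b : T) : linked3 a b -> ~~ cross (s a) (s b).
Proof.
move=> /andP[_ /existsP[l /and3P[ll al _]]]; apply/negP => ab.
have sbl := slot_uniq (slot_cross ab) (slot_cross al).
by have := leaf_neq b ll; rewrite sbl eqxx.
Qed.

(** A trail has only two ends. The vertex after [s a] is unique and tells the three kinds apart: it
    maps to [s a], or else it is a value of s, or a leaf. *)
Lemma linked_fun (a b c : T) : linked a b -> linked a c -> b = c.
Proof.
have H12 u v : linked1 a u -> cross (s a) v -> u = v -> False.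
  by move=> /andP[_ /eqP su] /and3P[_ _ vs] uv; move: vs; rewrite -uv su eqxx.
(* Besides u and [s y], the vertex y has only one neighbour, hence at most one preimage. *)
have preim y u v w : cross y u -> s v = y -> s w = y -> v = w.
  move=> /and3P[yu u1 u2] vy wy.
  have side t : s t = y -> [/\ e y t, t != s y & t != u].
    move=> ty; rewrite -ty s_edge_rev eq_sym s_s; split => //.
    by apply: contraNneq u2 => <-; rewrite ty.
  have [v1 v2 v3] := side v vy; have [w1 w2 w3] := side w wy.
  by apply: (@third_neighbour y u v w) => //; rewrite eq_sym.
move=> /or3P[ab|ab|ab] /or3P[ac|ac|ac].
- exact: slot_uniq (slot1 ab) (slot1 ac).
- by case: (H12 _ _ ab ac (slot_uniq (slot1 ab) (slot_cross ac))).
- move: ac => /andP[_ /existsP[l /and3P[_ al _]]].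
  by case: (H12 _ _ ab al (slot_uniq (slot1 ab) (slot_cross al))).
- by case: (H12 _ _ ac ab (slot_uniq (slot1 ac) (slot_cross ab))).
- have bc := slot_uniq (slot_cross ab) (slot_cross ac).
  by apply: (preim (s b) (s a)) => //; rewrite cross_sym.
- move: ac => /andP[_ /existsP[l /and3P[ll al _]]].
  by have sbl := slot_uniq (slot_cross ab) (slot_cross al); have := leaf_neq b ll; rewrite sbl eqxx.
- move: ab => /andP[_ /existsP[l /and3P[_ al _]]].
  by case: (H12 _ _ ac al (slot_uniq (slot1 ac) (slot_cross al))).
- move: ab => /andP[_ /existsP[l /and3P[ll al _]]].
  by have sbl := slot_uniq (slot_cross ac) (slot_cross al); have := leaf_neq c ll; rewrite sbl eqxx.
- move: ab ac => /andP[sab /existsP[l /and3P[_ al bl]]] /andP[sac /existsP[l' /and3P[_ al' cl]]].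
  have ll' := slot_uniq (slot_cross al) (slot_cross al'); rewrite -ll' in cl.
  suff sbc : s b = s c by apply: (preim (s b) l).
  move: al bl cl => /and3P[al a1 a2] /and3P[bl b1 b2] /and3P[cl c1 c2].
  by apply: (@third_neighbour l (s a)); rewrite 1?e_sym // 1?eq_sym.
Qed.

Definition mate (a : T) : T := odflt a [pick b | linked a b].

Lemma mate_linked (a b : T) : linked a b -> mate a = b.
Proof.
rewrite /mate => ab; case: pickP => [c ac|/(_ b)]; last by rewrite ab.
exact: linked_fun ac ab.
Qed.

(** The end of smaller rank names the trail; [sign0] is the colour of the edge at a relative to that
    end. *)
Definition key0 (a : T) : T :=
  if enum_rank (mate a) < enum_rank a then mate a else a.
Definition sign0 (a : T) : bool := (key0 a != a) && ~~ cross (s a) (s (key0 a)).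

Lemma linked_irr (a : T) : ~~ linked a a.
Proof. by rewrite /linked /linked1 /linked2 /linked3 /cross !eqxx e_irr. Qed.

Lemma key0_linked (a b : T) : linked a b ->
  key0 a = key0 b /\ sign0 a (+) sign0 b = ~~ cross (s a) (s b).
Proof.
move=> ab; have ba : linked b a by rewrite linked_sym.
have ne : a != b by apply: contraTneq ab => ->; exact: linked_irr.
rewrite /sign0 /key0 !(mate_linked ab) !(mate_linked ba).
have [lt|lt|/val_inj/enum_rank_inj abE] := ltngtP (enum_rank a) (enum_rank b).
- by rewrite eqxx ne /= [cross (s b) _]cross_sym.
- by rewrite eqxx eq_sym ne /= addbF.
- by rewrite abE eqxx in ne.
Qed.

Lemma key0_cases (a : T) : key0 a = a \/ linked a (key0 a).
Proof.
rewrite /key0; case: ifP; last by left.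
by rewrite /mate; case: pickP => [b ab _|_]; [right | left].
Qed.

Lemma key0_inj (a b : T) : key0 a = key0 b -> a = b \/ linked a b.
Proof.
move=> kab; have [ka|ka] := key0_cases a; have [kb|kb] := key0_cases b.
- by left; rewrite -ka kab.
- by right; rewrite linked_sym -ka kab.
- by right; rewrite -kb -kab.
- left; rewrite kab linked_sym in ka; rewrite linked_sym in kb; exact: linked_fun ka kb.
Qed.

Lemma linked_connect (a b : T) : linked a b -> connect e a b.
Proof.
have step u : connect e u (s u) by apply: connect1.
have back u : connect e (s u) u by apply: connect1; exact: s_edge_rev.
move=> /or3P[/andP[_ /eqP sab]|/and3P[ab _ _]|/andP[_ /existsP[l]]].
- by apply: connect_trans (step a) _; rewrite sab.
- by apply: connect_trans (step a) (connect_trans (connect1 ab) (back b)).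
- move=> /and3P[_ /and3P[al _ _] /and3P[bl _ _]].
  apply: connect_trans (step a) (connect_trans (connect1 al) _).
  by apply: connect_trans (back b); apply: connect1; rewrite e_sym.
Qed.

Lemma root_key0 (a : T) : fingraph.root e (key0 a) = fingraph.root e a.
Proof.
case: (key0_cases a) => [->//|/linked_connect ac]; apply/esym/fingraph.rootP => //.
exact: sym_connect_sym.
Qed.

(* [centre x] lies on the s-cycle of the component of x, since every s-orbit enters
   its cycle within #|T| steps; [tied x] is another vertex of that cycle whose edge
   belongs to a different trail, and the two edges get opposite colours. *)
Definition centre (x : T) : T := iter #|T| s (fingraph.root e x).
Definition tied (x : T) : T :=
  let a := centre x in if linked a (s a) then s (s a) else s a.

Lemma centre_key0 (a : T) : centre (key0 a) = centre a.
Proof. by rewrite /centre root_key0. Qed.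

Lemma tied_key0 (a : T) : tied (key0 a) = tied a.
Proof. by rewrite /tied centre_key0. Qed.

Lemma root_step (x : T) : fingraph.root e (s x) = fingraph.root e x.
Proof. by apply/esym/fingraph.rootP; [exact: sym_connect_sym | exact: connect1]. Qed.

Lemma centre_root (x y : T) : fingraph.root e x = fingraph.root e y -> centre x = centre y.
Proof. by rewrite /centre => ->. Qed.

Lemma root_centre (x : T) : fingraph.root e (centre x) = fingraph.root e x.
Proof.
rewrite /centre; elim: #|T| => [|n IH] /=; last by rewrite root_step.
by rewrite root_root //; exact: sym_connect_sym.
Qed.

Lemma root_tied (x : T) : fingraph.root e (tied x) = fingraph.root e x.
Proof. by rewrite /tied /=; case: ifP => _; rewrite !root_step root_centre. Qed.

Lemma centre_tied (x : T) : centre (tied x) = centre x.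
Proof. exact/centre_root/root_tied. Qed.

Lemma tied_tied (x : T) : tied (tied x) = tied x.
Proof. by rewrite {1}/tied centre_tied. Qed.

Lemma tied_centre (x : T) : tied (centre x) = tied x.
Proof. by rewrite {1}/tied (centre_root (root_centre x)). Qed.

(** Partners are unique, so [s a] and [s (s a)] are not both linked to the centre a, and [tied]
    picks one that is not. *)
Lemma key0_tied (x : T) : key0 (centre x) != key0 (tied x).
Proof.
apply/eqP => /key0_inj; rewrite /tied /=; set a := centre x.
case: ifP => [l1|l1] [ae|l2].
- by have := s_s a; rewrite -ae eqxx.
- have := linked_fun l1 l2 => ss; have := s_edge (s a); by rewrite -ss e_irr.
- by have := s_edge a; rewrite -ae e_irr.
- by rewrite l1 in l2.
Qed.

(** The trail of [tied j] gives up its own bit for that of the trail of [centre j]; [sign1] shifts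
    it so that these two vertices get opposite colours. *)
Definition key1 (j : T) : T := if j == key0 (tied j) then key0 (centre j) else j.
Definition sign1 (j : T) : bool :=
  (j == key0 (tied j)) && ~~ (sign0 (centre j) (+) sign0 (tied j)).
Definition key (x : T) : T := key1 (key0 x).
Definition sign (x : T) : bool := sign0 x (+) sign1 (key0 x).
Definition colour_of_bits (w : T -> bool) (x : T) : bool := w (key x) (+) sign x.

Lemma colour_linked (w : T -> bool) (a b : T) : linked a b ->
  colour_of_bits w a (+) colour_of_bits w b = ~~ cross (s a) (s b).
Proof.
move=> /key0_linked[kab <-]; rewrite /colour_of_bits /key /sign kab.
by case: (w _); case: (sign0 a); case: (sign0 b); case: (sign1 _).
Qed.

Lemma colour_tied (w : T -> bool) (x : T) :
  colour_of_bits w (centre x) != colour_of_bits w (tied x).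
Proof.
rewrite /colour_of_bits /key /sign /key1 /sign1 !tied_key0 !centre_key0.
rewrite tied_tied centre_tied tied_centre.
rewrite (negPf (key0_tied x)) eqxx /= addbF.
by case: (w _); case: (sign0 (centre x)); case: (sign0 (tied x)).
Qed.

Lemma key0_fibre (j x : T) : key0 x = j -> x \in [:: j; mate j].
Proof.
rewrite !inE; case: (key0_cases x) => [->->|xl <-]; first by rewrite eqxx.
by rewrite orbC linked_sym in xl *; rewrite (mate_linked xl) eqxx.
Qed.

(** A bit serves at most two trails, its own and the tied one of the component, and each trail has
    at most two ends. *)
Lemma card_key_fibre (i : T) : #|[set x | key x == i]| <= 4.
Proof.
set j := key0 (tied i).
apply: leq_trans (card_size [:: i; mate i; j; mate j]); apply/subset_leq_card/subsetP => x.
rewrite inE /key /key1 => /eqP; case: ifP => [/eqP k1 k2|_ /key0_fibre].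
  have rxi : fingraph.root e x = fingraph.root e i.
    by rewrite -k2 root_key0 root_centre root_key0.
  have : key0 x = j by rewrite k1 tied_key0 /j /tied (centre_root rxi).
  by move=> /key0_fibre; rewrite !inE => /orP[] ->; rewrite ?orbT.
by rewrite !inE => /orP[] ->; rewrite ?orbT.
Qed.

Hypothesis s_meet : forall x y, connect e x y ->
  exists z, fconnect s x z /\ fconnect s y z.

(** The orbit of x meets that of the root of its component, and the latter reaches a common vertex
    within [#|T|] steps, hence no later than the centre. *)
Lemma fconnect_centre (x : T) : fconnect s x (centre x).
Proof.
have [|z [xz rz]] := s_meet (_ : connect e x (fingraph.root e x)); first exact: connect_root.
apply: connect_trans xz _; rewrite /centre -(iter_findex rz).
have le : findex s (fingraph.root e x) z <= #|T|.
  by apply: ltnW; apply: leq_trans (findex_max rz) _; exact: max_card.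
by rewrite -(subnK le) iterD fconnect_iter.
Qed.

(** Every orbit passes through [centre x] and then [tied x], whose colours differ. *)
Lemma no_monochromatic_orbit (w : T -> bool) (x : T) (b : bool) :
  ~ (forall z, fconnect s x z -> colour_of_bits w z = b).
Proof.
move=> h; have := colour_tied w x; rewrite !h ?eqxx //; last exact: fconnect_centre.
apply: connect_trans (fconnect_centre x) _; rewrite /tied /=.
by case: ifP => _; [exact: (fconnect_iter s 2) | exact: fconnect1].
Qed.

End Trails.

(** * Colouring the edges *)

Section EdgeColouring.
Variables (T : finType) (e : rel T) (s : T -> T).
Hypotheses (e_sym : symmetric e) (e_irr : irreflexive e) (e_cubic : cubic e).
Hypothesis s_edge : forall x, e x (s x).
Hypothesis s_s : forall x, s (s x) != x.
Hypothesis s_leaves : no_adjacent_leaves e s.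

(** [K x] is the colour of the edge from x to [s x]. A cross edge at [x = s a] follows the edge of a
    on its trail, hence the negation; on an edge the default [false] is reached only between two
    leaves. *)
Definition dart_colour (K : T -> bool) (x y : T) : bool :=
  if s x == y then K x else if s y == x then K y else
  if [pick a | s a == x] is Some a then ~~ K a else
  if [pick b | s b == y] is Some b then ~~ K b else false.

Definition edge_colour (K : T -> bool) (A : {set T}) : bool :=
  if [pick p : T * T | (A == [set p.1; p.2]) && e p.1 p.2] is Some p
  then dart_colour K p.1 p.2 else false.

(** Only the default [false] is not negated, and [s_leaves] rules it out. *)
Lemma dart_colourN (K : T -> bool) (x y : T) : e x y ->
  dart_colour (fun z => ~~ K z) x y = ~~ dart_colour K x y.
Proof.
move=> exy; rewrite /dart_colour; case: ifP => // _; case: ifP => // _.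
case: pickP => // hx; case: pickP => // hy.
by have [[u us]|[u us]] := s_leaves exy; [have := hx u | have := hy u]; rewrite us eqxx.
Qed.

Section Consistent.
Variable K : T -> bool.
Hypothesis K_linked : forall a b, linked e s a b -> K a (+) K b = ~~ cross e s (s a) (s b).

(** The two orientations could disagree only on a cross edge with both ends in the image of s. It is
    the middle of a three-edge trail, whose ends have equal colours by [K_linked]. *)
Lemma dart_colour_sym (x y : T) : e x y -> dart_colour K x y = dart_colour K y x.
Proof.
move=> exy; rewrite /dart_colour; have [sxy|sxy] := eqVneq (s x) y.
  by have [syx|//] := eqVneq (s y) x; have := s_s x; rewrite sxy syx eqxx.
have [//|syx] := eqVneq (s y) x.
case: pickP => [a /eqP sa|hx]; case: pickP => [b /eqP sb|hy] //.
have cab : cross e s (s a) (s b) by rewrite sa sb /cross exy sxy syx.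
have /K_linked : linked e s a b by rewrite /linked /linked2 cab orbT.
by rewrite cab; case: (K a); case: (K b).
Qed.

Lemma edge_colourE (x y : T) : e x y -> edge_colour K [set x; y] = dart_colour K x y.
Proof.
move=> exy; rewrite /edge_colour.
case: pickP => [[u v] /= /andP[/eqP E euv]|/(_ (x, y))]; last first.
  by rewrite /= eqxx exy.
have := set21 u v; have := set22 u v; rewrite -E !inE.
have xy : x != y by apply: contraTneq exy => ->; rewrite e_irr.
have uv : u != v by apply: contraTneq euv => ->; rewrite e_irr.
move=> /orP[] /eqP vE /orP[] /eqP uE; rewrite ?vE ?uE ?eqxx // in uv *.
exact/esym/dart_colour_sym.
Qed.

(** Split by which of p and q map to v: both gives [linked1], exactly one is settled by the
    definition of [dart_colour], and none makes v a leaf, the midpoint of a [linked3] trail. *)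
Lemma dart_colour_turn (v p q : T) : e v p -> e v q -> p != q ->
  p != s v -> q != s v -> dart_colour K v p != dart_colour K v q.
Proof.
move=> vp vq pq ps qs.
have other a : s a = v -> a = p \/ a = q.
  move=> sa; have [->|ap] := eqVneq a p; [by left | right].
  apply: (@third_neighbour T e s e_cubic s_edge v p) => //; rewrite 1?eq_sym //.
  - by rewrite -sa e_sym.
  - by rewrite -sa s_s.
have xorb_neq (b c : bool) : b (+) c -> b != c by case: b; case: c.
have colp p' : p' != s v -> s p' = v -> dart_colour K v p' = K p'.
  by move=> p's sp; rewrite /dart_colour eq_sym (negPf p's) sp eqxx.
have colq p' q' : p' != q' -> q' != s v -> s p' = v -> s q' != v ->
    (forall a, s a = v -> a = p' \/ a = q') -> dart_colour K v q' = ~~ K p'.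
  move=> pq' qs' sp sq oth; rewrite /dart_colour eq_sym (negPf qs') (negPf sq).
  case: pickP => [a /eqP sa|/(_ p')]; last by rewrite sp eqxx.
  by case: (oth a sa) => ae; rewrite -?ae //; move: sq; rewrite -ae sa eqxx.
have [sp|sp] := eqVneq (s p) v; have [sq|sq] := eqVneq (s q) v.
- rewrite !colp //; apply: xorb_neq; rewrite K_linked; last first.
    by rewrite /linked /linked1 pq sp sq eqxx.
  by rewrite sp sq /cross e_irr.
- by rewrite colp // (colq p q) //; case: (K p).
- rewrite (colp q) // (colq q p) //; first by case: (K q).
    by rewrite eq_sym.
  by move=> a /other[]; [right | left].
have lv : leaf s v.
  apply/forallP => a; apply/eqP => sa.
  by case: (other a sa) => ae; [move: sp | move: sq]; rewrite -ae sa eqxx.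
have colF p' : e v p' -> p' != s v -> s p' != v ->
    exists2 a, s a = p' & dart_colour K v p' = ~~ K a.
  move=> vp' ps' sp'; rewrite /dart_colour eq_sym (negPf ps') (negPf sp').
  case: pickP => [a sa|_]; first by have := leaf_neq a lv; rewrite sa.
  case: pickP => [a /eqP sa|hp]; first by exists a.
  have [[u us]|[u us]] := s_leaves vp'; first by have := leaf_neq u lv; rewrite us eqxx.
  by have := hp u; rewrite us eqxx.
have [a sa ->] := colF p vp ps sp; have [b sb ->] := colF q vq qs sq.
have l3 : linked3 e s a b.
  rewrite /linked3 sa sb pq; apply/existsP; exists v.
  by rewrite lv /cross ![e _ v]e_sym vp vq sp sq ![s v == _]eq_sym ps qs.
have /K_linked : linked e s a b by rewrite /linked l3 !orbT.
by rewrite (linked3_cross e_sym e_cubic s_edge s_s l3); case: (K a); case: (K b).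
Qed.

Definition colour_rel (b : bool) : rel T := colour_graph e (edge_colour K) b.

Lemma colour_relE (b : bool) (x y : T) :
  colour_rel b x y = e x y && (dart_colour K x y == b).
Proof. by apply: andb_id2l => exy; rewrite edge_colourE. Qed.

Lemma colour_rel_sym (b : bool) : symmetric (colour_rel b).
Proof.
move=> x y; rewrite !colour_relE e_sym; case eyx: (e y x) => //=.
by rewrite dart_colour_sym // e_sym.
Qed.

(** By [dart_colour_turn], edges of one colour at v cannot both avoid [{v, s v}], and that edge has
    colour [K v]. *)
Lemma colour_rel_turn (b : bool) (v p q : T) : colour_rel b v p -> colour_rel b v q -> p != q ->
  (s v = p \/ s v = q) /\ K v = b.
Proof.
rewrite !colour_relE => /andP[vp /eqP cp] /andP[vq /eqP cq] pq.
have [sp|sp] := eqVneq (s v) p; [split; [by left|]|].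
  by move: cp; rewrite /dart_colour sp eqxx.
have [sq|sq] := eqVneq (s v) q; [split; [by right|]|].
  by move: cq; rewrite /dart_colour sq eqxx.
have := @dart_colour_turn v p q vp vq pq; rewrite cp cq eqxx !(eq_sym _ (s v)).
by move=> /(_ sp sq).
Qed.

Lemma colour_rel_deg2 (b : bool) (x y1 y2 y3 : T) : uniq [:: y1; y2; y3] ->
  colour_rel b x y1 -> colour_rel b x y2 -> colour_rel b x y3 -> False.
Proof.
rewrite /= !inE negb_or => /and3P[/andP[n12 n13] n23 _] r1 r2 r3.
have [h12 _] := colour_rel_turn r1 r2 n12; have [h13 _] := colour_rel_turn r1 r3 n13.
have [h23 _] := colour_rel_turn r2 r3 n23.
case: h12 => h12; case: h13 => h13; case: h23 => h23; move: n12 n13 n23;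
  by rewrite -?h12 -?h13 -?h23 ?eqxx.
Qed.

Lemma colour_rel_acyclic (b : bool) (c : seq T) :
  (forall x, ~ (forall z, fconnect s x z -> K z = b)) ->
  cycle (colour_rel b) c -> uniq c -> size c <= 2.
Proof.
move=> noorb rc uc; rewrite leqNgt; apply/negP => c3.
(* At each vertex [s x] is the next or the previous vertex of the cycle; reversing the cycle turns
   the latter case into the former. *)
suff forward d : cycle (colour_rel b) d -> uniq d -> 2 < size d ->
    forall x, x \in d -> s x != next d x.
  have [x xc] : exists x, x \in c by case: (c) c3 => // x q _; exists x; rewrite mem_head.
  have rn := next_cycle rc xc; have rp := prev_cycle rc xc.
  rewrite colour_rel_sym in rp.
  have np : next c x != prev c x.
    by apply: contraNneq (next_next_neq uc c3 xc) => ->; rewrite next_prev.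
  have [[h|h] _] := colour_rel_turn rn rp np.
    by have := forward c rc uc c3 x xc; rewrite h eqxx.
  have := forward (rev c) _ _ _ x; rewrite rev_uniq size_rev mem_rev next_rev // h eqxx.
  rewrite rev_cycle (eq_cycle (e' := colour_rel b)); last by move=> u v; rewrite colour_rel_sym.
  by move=> /(_ rc uc c3 xc).
move=> rd ud d3 x xd; apply/negP => /eqP sx.
(* One step along s forces the next, since [s_s] excludes going back; the whole orbit then stays on
   the cycle and has colour b. *)
have inv z : fconnect s x z -> z \in d /\ s z = next d z.
  move=> /iter_findex <-; elim: (findex _ _ _) => [|n [zd sz]] //=.
  set z' := iter n s x in zd sz *; have yd : next d z' \in d by rewrite mem_next.
  rewrite sz; split => //; have rn := next_cycle rd yd; have rp := next_cycle rd zd.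
  rewrite colour_rel_sym in rp.
  have [[//|h] _] := colour_rel_turn rn rp (next_next_neq ud d3 zd).
  by have := s_s z'; rewrite sz h eqxx.
apply: (noorb x) => z /inv[zd sz].
have rn := next_cycle rd zd; have rp := prev_cycle rd zd; rewrite colour_rel_sym in rp.
have [] // := colour_rel_turn rn rp.
by apply: contraNneq (next_next_neq ud d3 zd) => ->; rewrite next_prev.
Qed.

(** From vertex number L of a path of length at least 2L, s moves along the path and cannot turn
    back. So the first L vertices of this orbit are inner vertices of the path, where [K] is b. *)
Lemma colour_path_bound (b : bool) (L l : nat) (S : {set T}) :
  (forall x, exists2 i, i < L & K (iter i s x) != b) ->
  is_path_of_length (colour_rel b) l S -> l < L.*2.
Proof.
move=> nochain /existsP[f /and3P[/injectiveP fi _ /forallP fr]]; rewrite ltnNge; apply/negP => lL.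
pose v i := f (inord i).
have rv i j : i <= l -> j <= l -> colour_rel b (v i) (v j) = (i.+1 == j) || (j.+1 == i).
  move=> il jl; have /forallP/(_ (inord j))/eqP -> := fr (inord i).
  by rewrite /path_graph /= !inordK.
have vi i j : i <= l -> j <= l -> v i = v j -> i = j.
  by move=> il jl /fi /(congr1 val); rewrite /= !inordK.
have L0 : 0 < L by have [i iL _] := nochain (f ord0); apply: leq_ltn_trans iL.
have turn i : 0 < i -> i < l -> (s (v i) = v i.-1 \/ s (v i) = v i.+1) /\ K (v i) = b.
  move=> i0 il; apply: colour_rel_turn.
  - by rewrite rv; lia.
  - by rewrite rv; lia.
  - by apply/eqP => /vi; lia.
have Ll : L < l by lia.
have [[back|fwd] _] := turn L L0 Ll.
  have it j : j < L -> iter j s (v L) = v (L - j) /\ s (v (L - j)) = v (L - j).-1.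
    elim: j => [|j IH] jL /=; first by rewrite subn0.
    have [h1 h2] := IH (ltnW jL); rewrite h1 h2; have -> : L - j.+1 = (L - j).-1 by lia.
    split => //; have [[//|h] _] := turn (L - j).-1 ltac:(lia) ltac:(lia).
    have := s_s (v (L - j)); rewrite h2 h prednK ?eqxx; lia.
  have [j jL] := nochain (v L); have [-> _] := it j jL.
  by have [_ ->] := turn (L - j) ltac:(lia) ltac:(lia); rewrite eqxx.
have it j : j < L -> iter j s (v L) = v (L + j) /\ s (v (L + j)) = v (L + j).+1.
  elim: j => [|j IH] jL /=; first by rewrite addn0.
  have [h1 h2] := IH (ltnW jL); rewrite h1 h2 addnS.
  split => //; have [|| [h|//] _] := turn (L + j).+1; [lia|lia|].
  by have := s_s (v (L + j)); rewrite h2 h eqxx.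
have [j jL] := nochain (v L); have [-> _] := it j jL.
by have [||_ ->] := turn (L + j); [lia | lia | rewrite eqxx].
Qed.

End Consistent.

End EdgeColouring.

(** This limits the set of vertices at which a change of one bit is felt. *)
Lemma dart_colour_local (T : finType) (e : rel T) (s : T -> T) (K K' : T -> bool) (x y : T) :
  (forall v, s v = x \/ e x (s v) -> K v = K' v) -> e x (s x) -> e x y ->
  dart_colour s K x y = dart_colour s K' x y.
Proof.
move=> h xs xy; rewrite /dart_colour; case: ifP => [_|_]; first by apply: h; right.
case: ifP => [/eqP syx|_]; first by apply: h; left.
case: pickP => [a /eqP sa|_]; first by rewrite h //; left.
by case: pickP => [a /eqP sa|//]; rewrite h //; right; rewrite sa.
Qed.

Lemma leq_card_fibres (T : finType) (f : T -> T) (m : nat) (A : {set T}) :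
  (forall i, #|[set x | f x == i]| <= m) -> #|A| <= m * #|f @: A|.
Proof.
move=> fm; rewrite -sum1_card (partition_big_imset f) /= mulnC -sum_nat_const.
apply: leq_sum => i _; apply: leq_trans (fm i); rewrite sum1_card.
by apply/subset_leq_card/subsetP => x; rewrite !inE => /andP[].
Qed.

(** * The colouring as a function of independent bits *)

Section RandomColouring.
Variables (T : finType) (e : rel T).
Hypotheses (e_sym : symmetric e) (e_irr : irreflexive e) (e_cubic : cubic e).

(** This is the interface to the probabilistic part, which forgets how s and the colouring were
    built. *)
Lemma exists_bit_colouring :
  exists (c : (T -> bool) -> {set T} -> bool) (s key : T -> T) (sign : T -> bool),
  let count w b t := num_path_components (colour_graph e (c w) b) t in
  [/\ forall i, #|[set x | key x == i]| <= 4,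
      forall w x b, ~ (forall z, fconnect s x z -> w (key z) (+) sign z = b),
      forall w w' b t, (forall j, w' j = ~~ w j) -> count w' b t = count w (~~ b) t,
      forall w w' i b t, (forall j, j != i -> w j = w' j) -> count w b t <= count w' b t + 16 &
      forall w b L,
        (forall x, exists2 i, i < L & w (key (iter i s x)) (+) sign (iter i s x) != b) ->
        (forall S, S \in components (colour_graph e (c w) b) ->
          exists2 l, is_path_of_length (colour_graph e (c w) b) l S & l < L.*2) /\
        (forall t, 0 < count w b t -> t < L.*2)].
Proof.
have [s [[s1 s2] sl]] := exists_leaf_sparse_flow e_sym e_irr e_cubic.
have s_edge x : e x (s x) by have [] := s1 x isT.
have s_s x : s (s x) != x by have [] := s1 x isT.
have s_meet x y : connect e x y -> exists z, fconnect s x z /\ fconnect s y z by exact: s2.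
pose K w := colour_of_bits e s w.
have Kl w := colour_linked e_sym e_irr e_cubic s_edge s_s w.
pose c w := edge_colour e s (K w).
have cE w b x y : colour_graph e (c w) b x y = e x y && (dart_colour s (K w) x y == b).
  by rewrite -[LHS]/(colour_rel e s (K w) b x y) colour_relE // => a b'; exact: Kl.
have c_sym w b : symmetric (colour_graph e (c w) b).
  by apply: (@colour_rel_sym _ e s) => // a b'; exact: Kl.
exists c, s, (key e s), (sign e s); split.
- exact: card_key_fibre.
- exact: no_monochromatic_orbit.
- move=> w w' b t ww'.
  have E x y : colour_graph e (c w') b x y = colour_graph e (c w) (~~ b) x y.
    rewrite !cE; apply: andb_id2l => xy.
    rewrite (@dart_colour_local _ e s _ (fun z => ~~ K w z)) //; last first.
      by move=> v _; rewrite /K /colour_of_bits ww' addNb.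
    by rewrite (dart_colourN sl) //; case: (dart_colour _ _ _ _); case: b.
  (* Equal relations are perturbations of each other on the empty set. *)
  apply/eqP; rewrite eqn_leq -[X in _ <= X]addn0 -[X in _ && (_ <= X)]addn0 -(cards0 T).
  by apply/andP; split; apply: num_path_components_perturb.
- move=> w w' i b t ww'.
  (* A bit controls at most 4 of the edges {v, s v}; every edge whose colour changes
     meets one of the corresponding vertices s v. *)
  pose near v := s v |: [set x | e x (s v)].
  pose U := \bigcup_(v in [set v | key e s v == i]) near v.
  have U16 : #|U| <= 16.
    (* Each [near v] consists of [s v] and its three neighbours, and there are at most four such
       v. *)
    apply: leq_trans (_ : \sum_(v in [set v | key e s v == i]) 4 <= _).
      rewrite /U; elim/big_rec2: _ => [|v m A _ Am]; first by rewrite cards0.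
      rewrite (leq_trans (leq_card_setU _ _).1) // leq_add // cardsU1.
      have -> : #|[set x | e x (s v)]| = 3.
        by rewrite -(e_cubic (s v)); apply: eq_card => x; rewrite !inE e_sym.
      by case: (_ \notin _).
    by rewrite sum_nat_const (@leq_mul _ _ 4 4) // card_key_fibre.
  apply: leq_trans (_ : num_path_components (colour_graph e (c w') b) t + #|U| <= _); last first.
    by rewrite leq_add2l.
  apply: num_path_components_perturb => [|x y xU]; first exact: c_sym.
  rewrite !cE; apply: andb_id2l => xy; congr (_ == _).
  apply: dart_colour_local (s_edge x) xy => v sv; rewrite /K /colour_of_bits ww' //.
  apply: contraNneq xU => kv; apply/bigcupP; exists v; first by rewrite inE kv.
  by rewrite !inE; case: sv => [->|->]; rewrite ?eqxx ?orbT.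
- move=> w b L nochain.
  have bound t S := @colour_path_bound T e s e_sym e_irr e_cubic s_edge s_s sl
    _ (Kl w) b L t S nochain.
  split.
    move=> S CS; have [l lS] : exists l, is_path_of_length (colour_graph e (c w) b) l S.
      apply: component_is_path CS => //.
      + by move=> x y1 y2 y3; apply: (colour_rel_deg2 e_sym e_irr e_cubic s_edge s_s sl (Kl w)).
      + move=> p; apply: (colour_rel_acyclic e_sym e_irr e_cubic s_edge s_s sl (Kl w)) => x.
        exact: no_monochromatic_orbit.
      + by move=> x; rewrite cE e_irr.
    by exists l => //; apply: bound lS.
  by move=> t /card_gt0P[S]; rewrite inE => /andP[_ /bound].
Qed.

End RandomColouring.

(** * Averages over bits *)

Local Open Scope ring_scope.

Section BitAverages.
Variables (R : realFieldType) (I : finType).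
Local Notation bits := {ffun I -> bool}.

Definition set_bit (w : bits) (i : I) (b : bool) : bits :=
  [ffun j => if j == i then b else w j].

(** The expectation over independent fair bits at the places in l, the other bits being those of w;
    it is taken bit by bit to allow induction on l. *)
Fixpoint average (l : seq I) (f : bits -> R) (w : bits) : R :=
  if l is i :: l' then
    (average l' f (set_bit w i false) + average l' f (set_bit w i true)) / 2
  else f w.

Lemma le_average (l : seq I) (f g : bits -> R) (w : bits) :
  (forall w', f w' <= g w') -> average l f w <= average l g w.
Proof.
move=> fg; elim: l w => [|i l IH] w //=.
by have := IH (set_bit w i false); have := IH (set_bit w i true); lra.
Qed.

Lemma average_exists (l : seq I) (f : bits -> R) (w : bits) (a : R) :
  average l f w < a -> exists w', f w' < a.
Proof.
elim: l w => [|i l IH] w /= fa; first by exists w.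
have [lt|ge] := ltP (average l f (set_bit w i false)) a; first exact: IH lt.
by apply: (IH (set_bit w i true)); lra.
Qed.

Lemma averageD (l : seq I) (f g : bits -> R) (w : bits) :
  average l (fun w => f w + g w) w = average l f w + average l g w.
Proof. by elim: l w => [|i l IH] w //=; rewrite !IH; field. Qed.

Lemma averageZ (l : seq I) (a : R) (f : bits -> R) (w : bits) :
  average l (fun w => a * f w) w = a * average l f w.
Proof. by elim: l w => [|i l IH] w //=; rewrite !IH; field. Qed.

Lemma average_sum (K : finType) (P : pred K) (l : seq I) (f : K -> bits -> R) (w : bits) :
  average l (fun w => \sum_(k | P k) f k w) w = \sum_(k | P k) average l (f k) w.
Proof. by elim: l w => [|i l IH] w //=; rewrite !IH -big_split /= mulr_suml. Qed.

Lemma average_eq (l : seq I) (f : bits -> R) (w : bits) (a : R) :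
  (forall w' : bits, (forall j, j \notin l -> w' j = w j) -> f w' = a) -> average l f w = a.
Proof.
elim: l w => [|i l IH] w fa /=; first by apply: fa.
suff h b : average l f (set_bit w i b) = a by rewrite !h; field.
apply: IH => w' agree; apply: fa => j; rewrite inE negb_or => /andP[ji jl].
by rewrite agree // ffunE (negPf ji).
Qed.

Lemma average_irrel (l : seq I) (f : bits -> R) (w w' : bits) :
  (forall j, j \notin l -> w j = w' j) -> average l f w = average l f w'.
Proof.
elim: l w w' => [|i l IH] w w' agree /=.
  by congr f; apply/ffunP => j; rewrite agree.
congr ((_ + _) / 2); apply: IH => j jl; rewrite !ffunE; case: eqP => // /eqP ji;
  by apply: agree; rewrite inE negb_or ji.
Qed.

Definition flip (w : bits) : bits := [ffun j => ~~ w j].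

Lemma average_flip (l : seq I) (f : bits -> R) (w : bits) :
  average l (fun w => f (flip w)) w = average l f (flip w).
Proof.
elim: l w => [|i l IH] w //=; rewrite !IH [RHS]/= addrC.
congr ((average l f _ + average l f _) / 2); apply/ffunP => j; rewrite !ffunE; by case: eqP.
Qed.

(** Flipping all bits preserves the average, which is thus its own negative. *)
Lemma average_odd (f : bits -> R) (w : bits) :
  (forall w, f (flip w) = - f w) -> average (enum I) f w = 0.
Proof.
move=> odd; have := average_flip (enum I) f w.
rewrite [RHS](@average_irrel _ _ _ w); last by move=> j; rewrite mem_enum.
have -> : average (enum I) (fun w => f (flip w)) w = average (enum I) (fun w => -1 * f w) w.
  by apply/le_anti; rewrite !le_average // => w'; rewrite odd mulN1r.
by rewrite averageZ; lra.
Qed.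

Section Lipschitz.
Variables (f : bits -> R) (D : R).
Hypothesis lip : forall w i b, `|f w - f (set_bit w i b)| <= D.

Lemma average_lipschitz (l : seq I) (w : bits) (i : I) (b : bool) :
  `|average l f w - average l f (set_bit w i b)| <= D.
Proof.
elim: l w => [|k l IH] w //=; have [->|ik] := eqVneq i k.
  have ss b' : set_bit (set_bit w k b) k b' = set_bit w k b'.
    by apply/ffunP => j; rewrite !ffunE; case: eqP.
  by rewrite !ss subrr normr0; apply: le_trans (normr_ge0 _) (lip w i b).
have ss b' : set_bit (set_bit w i b) k b' = set_bit (set_bit w k b') i b.
  by apply/ffunP => j; rewrite !ffunE; have [->|] := eqVneq j k; rewrite // eq_sym (negPf ik).
have := IH (set_bit w k true); have := IH (set_bit w k false).
by rewrite !ss !ler_norml; lra.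
Qed.

(* E f^2 - (E f)^2 for the average over one more bit is E of the two conditional
   variances plus (f_0 - f_1)^2 / 4, where f_0 and f_1 are the conditional means. *)
Lemma average_square (l : seq I) (w : bits) :
  average l (fun w => f w ^+ 2) w <= average l f w ^+ 2 + (size l)%:R * (D ^+ 2 / 4).
Proof.
elim: l w => [|k l IH] w /=; first by rewrite mul0r addr0.
have h0 := IH (set_bit w k false); have h1 := IH (set_bit w k true).
have := average_lipschitz l (set_bit w k false) k true.
have -> : set_bit (set_bit w k false) k true = set_bit w k true.
  by apply/ffunP => j; rewrite !ffunE; case: eqP.
move: h0 h1; set a0 := average l f _; set a1 := average l f _ => h0 h1 a01.
have {a01} : (a0 - a1) ^+ 2 <= D ^+ 2.
  by rewrite -real_normK ?num_real // lerXn2r ?nnegrE // (le_trans _ a01).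
rewrite -[(size l).+1%:R]natr1; move: h0 h1.
move: (average l (fun=> _) _) (average l (fun=> _) _) => A B.
nra.
Qed.

End Lipschitz.

(** P prescribes the bits in J, so whenever a place in J is averaged, one of the two branches
    contributes 0 and the bound halves. *)
Lemma average_event (l : seq I) (J : {set I}) (P : pred bits) (w : bits) :
  uniq l -> {subset J <= l} ->
  (forall w1 w2 : bits, P w1 -> P w2 -> {in J, w1 =1 w2}) ->
  average l (fun w => (P w)%:R) w <= (1 / 2) ^+ #|J|.
Proof.
elim: l J w => [|i l IH] J w /=.
  move=> _ Jl _; have -> : J = set0 by apply/setP => j; rewrite inE; apply/negP => /Jl.
  by rewrite cards0 expr0 lern1 leq_b1.
move=> /andP[il ul] Jl PJ; have [iJ|iJ] := boolP (i \in J); last first.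
  have h b : average l (fun w => (P w)%:R) (set_bit w i b) <= (1 / 2) ^+ #|J|.
    apply: IH => // j jJ; have := Jl j jJ; rewrite inE => /orP[/eqP ji|//].
    by rewrite -ji jJ in iJ.
  by have := h true; have := h false; lra.
have h b : average l (fun w => (P w)%:R) (set_bit w i b) <= (1 / 2) ^+ #|J :\ i|.
  apply: IH => // [j|w1 w2 P1 P2 j]; last by move=> /setD1P[_ jJ]; apply: PJ.
  by rewrite !inE => /andP[ji jJ]; have := Jl j jJ; rewrite inE (negPf ji).
have z : exists b, average l (fun w => (P w)%:R) (set_bit w i b) = 0 :> R.
  have [/existsP[w1 /andP[P1 w1i]]|/existsPn no] := boolP [exists w1, P w1 && w1 i];
    [exists false | exists true].
    apply: average_eq => w' agree; case P': (P w') => //.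
    by have := PJ _ _ P1 P' i iJ; rewrite w1i agree // ffunE eqxx.
  apply: average_eq => w' agree; case P': (P w') => //.
  by have := no w'; rewrite P' agree // ffunE eqxx.
rewrite (cardsD1 i) iJ exprS; have [b zb] := z.
by case: b zb => ->; have := h true; have := h false; rewrite ?add0r ?addr0; lra.
Qed.

End BitAverages.

(** * Choice of the bits *)

Lemma average_chain (R : realFieldType) (T : finType) (s key : T -> T) (sign : T -> bool)
    (x : T) (w0 : {ffun T -> bool}) (b : bool) (q : nat) :
  (forall i, (#|[set x | key x == i]| <= 4)%N) ->
  (forall (w : T -> bool) x b, ~ (forall z, fconnect s x z -> w (key z) (+) sign z = b)) ->
  average (enum T) (fun w : {ffun T -> bool} =>
    [forall i : 'I_(4 * q), w (key (iter i s x)) (+) sign (iter i s x) == b]%:R) w0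
    <= (1 / 2 : R) ^+ q.
Proof.
move=> key4 noorb; set P := fun w : {ffun T -> bool} =>
  [forall i : 'I_(4 * q), w (key (iter i s x)) (+) sign (iter i s x) == b].
have PE w i : P w -> (i < 4 * q)%N -> w (key (iter i s x)) = b (+) sign (iter i s x).
  by move=> /forallP Pw iq; have /eqP <- := Pw (Ordinal iq); rewrite -addbA addbb addbF.
(* A chain that repeats a vertex contains a full orbit, which is never monochromatic, so the event
   is empty. *)
have [uni|] := boolP (uniq (traject s x (4 * q))); last first.
  move=> nu; have [m e4] : exists m, (4 * q = m.+1)%N.
    by case: (4 * q)%N nu => [|m] // _; exists m.
  rewrite e4 looping_uniq negbK in nu; have lo := loopingP nu.
  rewrite (@average_eq _ _ _ _ _ 0) ?exprn_ge0 ?divr_ge0 // => w' _.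
  suff Pw : ~~ P w' by move: Pw; rewrite /P => /negbTE ->.
  apply/negP => Pw; case: (noorb w' x b) => z /iter_findex <-.
  have /trajectP[i iq ->] := lo (findex s x z).
  by rewrite (PE _ _ Pw) ?e4 1?ltnW // addbK.
(* Otherwise 4q distinct vertices use at least q different keys, and the event prescribes the bit of
   each key. *)
pose A := [set y in traject s x (4 * q)].
have cA : (#|A| = 4 * q)%N by rewrite cardsE (card_uniqP uni) size_traject.
have Jq : (q <= #|key @: A|)%N.
  by rewrite -(leq_pmul2l (isT : (0 < 4)%N)) -cA; apply: leq_card_fibres.
apply: le_trans (_ : (1 / 2) ^+ #|key @: A| <= _); last first.
  by apply: ler_wiXn2l => //; lra.
apply: average_event; first exact: enum_uniq.
  by move=> j _; rewrite mem_enum.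
move=> w1 w2 P1 P2 j /imsetP[y]; rewrite inE => /trajectP[i iq ->] ->.
by rewrite !PE.
Qed.

Lemma exists_balanced_bits (R : realFieldType) (T : finType) (s key : T -> T) (sign : T -> bool)
    (N : (T -> bool) -> bool -> nat -> nat) (q : nat) (a : R) :
  (forall i, (#|[set x | key x == i]| <= 4)%N) ->
  (forall (w : T -> bool) x b, ~ (forall z, fconnect s x z -> w (key z) (+) sign z = b)) ->
  (forall w w' b t, (forall j, w' j = ~~ w j) -> N w' b t = N w (~~ b) t) ->
  (forall w w' i b t, (forall j, j != i -> w j = w' j) -> (N w b t <= N w' b t + 16)%N) ->
  0 < a -> (#|T|).*2%:R * (1 / 2) ^+ q + (8 * q)%:R * (#|T|%:R * 256) / a < 1 ->
  exists w : T -> bool,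
    (forall x b, exists2 i, (i < 4 * q)%N & w (key (iter i s x)) (+) sign (iter i s x) != b) /\
    (forall t, (t < 8 * q)%N -> ((N w true t)%:R - (N w false t)%:R) ^+ 2 < a).
Proof.
move=> key4 noorb Nflip Nlip a0 small.
pose X t (w : {ffun T -> bool}) : R := (N w true t)%:R - (N w false t)%:R.
pose P (p : T * bool) (w : {ffun T -> bool}) :=
  [forall i : 'I_(4 * q), w (key (iter i s p.1)) (+) sign (iter i s p.1) == p.2].
pose w0 : {ffun T -> bool} := [ffun=> false].
(* One average combines the union bound over chains with Chebyshev over t: where the sum is below 1,
   no chain is monochromatic and every [X t w ^+ 2] is below a. *)
have [w] : exists w, \sum_(p : T * bool) (P p w)%:R + a^-1 * \sum_(t < 8 * q) X t w ^+ 2 < 1.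
  apply: (@average_exists R T (enum T) _ w0); apply: le_lt_trans small.
  rewrite averageD average_sum averageZ average_sum; apply: lerD.
    apply: le_trans (_ : \sum_(p : T * bool) (1 / 2) ^+ q <= _).
      by apply: ler_sum => p _; apply: average_chain.
    by rewrite sumr_const card_prod card_bool muln2 mulr_natl.
  rewrite mulrC; apply: ler_wpM2r; first by rewrite invr_ge0 ltW.
  apply: le_trans (_ : \sum_(t < 8 * q) (#|T|%:R * 256 : R) <= _); last first.
    by rewrite sumr_const card_ord -[X in X <= _]mulr_natl.
  apply: ler_sum => t _.
  (* One bit moves each of the two counts by at most 16. *)
  have lip w i b : `|X t w - X t (set_bit w i b)| <= 32.
    have agree j : j != i -> w j = set_bit w i b j by move=> /negPf ji; rewrite ffunE ji.
    have agree' j : j != i -> set_bit w i b j = w j by move=> /agree.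
    have := Nlip _ _ i true t agree; have := Nlip _ _ i false t agree.
    have := Nlip _ _ i true t agree'; have := Nlip _ _ i false t agree'.
    rewrite -!(ler_nat R) !natrD /X ler_norml; lra.
  (* The mean is 0 by colour symmetry, and each bit contributes 32 ^ 2 / 4 = 256. *)
  have := average_square lip (enum T) w0; rewrite (@average_odd _ _ (X t)) => [|w].
    by rewrite expr0n add0r -cardE => /le_trans; apply; rewrite ler_wpM2l //; lra.
  by rewrite /X !(Nflip w (flip w)) ?opprB // => j; rewrite ffunE.
pose S1 : R := \sum_(p : T * bool) (P p w)%:R; pose S2 := \sum_(t < 8 * q) X t w ^+ 2.
rewrite -/S1 -/S2 => lt1.
have S1_ge0 : 0 <= S1 by apply: sumr_ge0.
have a_ge0 : 0 <= a^-1 by rewrite invr_ge0 ltW.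
have S2_ge0 : 0 <= a^-1 * S2 by rewrite mulr_ge0 // sumr_ge0 // => t _; apply: sqr_ge0.
exists w; split.
  move=> x b; have : ~~ P (x, b) w.
    apply/negP => Pxb; have : 1 <= S1; last by lra.
    by rewrite /S1 (bigD1 (x, b)) //= Pxb lerDl sumr_ge0.
  by move=> /forallPn[i h]; exists i.
move=> t tq; have : a^-1 * X t w ^+ 2 <= a^-1 * S2.
  rewrite ler_wpM2l // /S2 (bigD1 (Ordinal tq)) //= lerDl.
  by apply: sumr_ge0 => ? _; apply: sqr_ge0.
rewrite -/(X t w) => h; have : a^-1 * X t w ^+ 2 < 1 by lra.
by rewrite mulrC ltr_pdivrMr ?mul1r.
Qed.

(** * Constants and conclusion *)

Lemma cube_le_exp2 (a : nat) : exists m0, forall m, (m0 <= m)%N -> ((a * (m + 3)) ^ 3 <= 2 ^ m)%N.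
Proof.
(* One factor [2 ^ k] of [2 ^ m] absorbs [(8 * a) ^ 3], which is at most k; three more absorb
   [k.+1 ^ 3]. *)
exists (4 * (8 * a) ^ 3)%N => m am; pose k := (m %/ 4)%N.
have mk : (m < 4 * k.+1)%N by rewrite mulnC ltn_ceil.
have km : (4 * k <= m)%N by rewrite mulnC leq_trunc_div.
have ak : ((8 * a) ^ 3 <= k)%N by rewrite leq_divRL // mulnC.
apply: leq_trans (_ : (8 * a * k.+1) ^ 3 <= _)%N.
  by rewrite leq_exp2r // [(8 * a)%N]mulnC -mulnA leq_mul2l; apply/orP; right; lia.
apply: leq_trans (_ : 2 ^ k * (2 ^ k) ^ 3 <= _)%N.
  rewrite expnMn leq_mul //; first by apply: leq_trans ak (ltnW (ltn_expl _ _)).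
  by rewrite leq_exp2r // ltn_expl.
by rewrite -expnS -expnM leq_exp2l //; lia.
Qed.

From mathcomp Require Import all_classical all_reals all_analysis.

Theorem theorem1p4 (R : realType) :
  exists (C : R) (n0 : nat),
    forall (n : nat), (n0 <= n)%N ->
    forall (T : finType) (e : rel T),
      symmetric e -> irreflexive e -> cubic e -> #|T| = n ->
      exists c : {set T} -> bool,
        (forall (b : bool) (S : {set T}),
           S \in components (colour_graph e c b) ->
           exists2 l : nat,
             is_path_of_length (colour_graph e c b) l S
             & l%:R <= C * ln n%:R) /\
        (forall t : nat, (1 <= t)%N ->
           `| (num_path_components (colour_graph e c red) t)%:R
              - (num_path_components (colour_graph e c blue) t)%:R |
           <= (n%:R : R) `^ (2 / 3)).
Proof.
(* With j the integer part of the binary logarithm of n, this is the source of the constant 32. *)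
have linear i j : (0 < j)%N -> (i < (4 * (j + 3)).*2)%N -> (i <= 32 * j)%N by lia.
have [m0 hm0] := cube_le_exp2 4096.
exists (32 / ln 2), (2 ^ m0.+1)%N => n n0 T e e_sym e_irr e_cubic cT.
have [c [s [key [sign [key4 noorb flipN lipN short]]]]] :=
  exists_bit_colouring e_sym e_irr e_cubic.
have n_gt0 : (0 < n)%N by apply: leq_trans n0; rewrite expn_gt0.
pose k := trunc_log 2 n.
have nk : (n < 2 ^ k.+1)%N by apply: trunc_log_ltn.
have kn : (2 ^ k <= n)%N by apply: trunc_logP.
have m0k : (m0 < k)%N.
  by rewrite -ltnS -(@ltn_exp2l 2) //; apply: leq_ltn_trans n0 nk.
(* The 3 makes [2 ^ q] exceed 4n, which keeps the union bound over 2n chain events below 1/2. *)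
pose q := (k + 3)%N; pose y : R := n%:R `^ (2 / 3).
have nR : (0 : R) < n%:R by rewrite ltr0n.
have y0 : 0 < y by rewrite powR_gt0.
have y3 : y ^+ 3 = n%:R ^+ 2.
  rewrite /y -powR_mulrn ?powR_ge0 // -powRrM -powR_mulrn ?ler0n //.
  by congr (_ `^ _); field.
(* This is the cube root of n. *)
pose z := y ^+ 2 / n%:R.
have z0 : 0 < z by rewrite divr_gt0 // exprn_gt0.
have z3 : z ^+ 3 = n%:R.
  rewrite /z expr_div_n -exprM mulnC exprM y3; field; exact: lt0r_neq0.
(* Here n has to be large; the Chebyshev term 2048 q / z is then at most 1/2. *)
have qz : 4096 * q%:R <= z.
  have : ((4096 * q)%:R : R) ^+ 3 <= z ^+ 3.
    by rewrite z3 -natrX ler_nat; apply: leq_trans kn; apply: hm0; apply: ltnW.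
  by rewrite ler_pXn2r ?nnegrE ?ler0n ?natrM // ltW.
have small : (#|T|).*2%:R * (1 / 2) ^+ q + (8 * q)%:R * (#|T|%:R * 256) / (y ^+ 2) < 1.
  rewrite cT; have h1 : n.*2%:R * (1 / 2) ^+ q < 1 / 2 :> R.
    have e2 : (2 : R) ^+ q = 4 * 2 ^+ k.+1 by rewrite /q addn3 !exprS; ring.
    have nk' : (n%:R : R) < 2 ^+ k.+1 by rewrite -natrX ltr_nat.
    rewrite expr_div_n expr1n mul1r ltr_pdivrMr ?exprn_gt0 // e2 -muln2 natrM; lra.
  have h2 : (8 * q)%:R * (n%:R * 256) / (y ^+ 2) <= 1 / 2 :> R.
    have -> : (8 * q)%:R * (n%:R * 256) / (y ^+ 2) = 2048 * q%:R / z.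
      rewrite /z natrM; field; by rewrite !lt0r_neq0.
    by rewrite ler_pdivrMr //; lra.
  by lra.
have [w [nochain close]] := exists_balanced_bits key4 noorb flipN lipN (exprn_gt0 2 y0) small.
have bound b := short w b (4 * q)%N (fun x => nochain x b).
have q8 : (8 * q = (4 * q).*2)%N by rewrite -mul2n mulnA.
exists (c w); split.
  move=> b S CS; have [l lS lq] := (bound b).1 S CS; exists l => //.
  have k_gt0 : (0 < k)%N by apply: leq_ltn_trans m0k.
  have ln2 : 0 < ln 2 :> R by rewrite ln_gt0 // ltr1n.
  have kln : k%:R * ln 2 <= ln n%:R :> R.
    by rewrite mulr_natl -lnXn // ler_ln ?posrE ?exprn_gt0 // -natrX ler_nat.
  apply: le_trans (_ : 32 * k%:R <= _).
    by rewrite -natrM ler_nat; apply: linear.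
  by rewrite mulrAC ler_pdivlMr // -mulrA ler_pM2l.
move=> t _; have [tq|qt] := ltnP t (8 * q).
  have := close t tq; rewrite -/y => /ltW.
  by rewrite -[X in X <= _]real_normK ?num_real // ler_pXn2r ?nnegrE ?normr_ge0 // ltW.
(* Beyond the range covered by Chebyshev, no monochromatic path has length t. *)
have z_count b : num_path_components (colour_graph e (c w) b) t = 0%N.
  by apply/eqP; rewrite eqn0Ngt; apply/negP => /(bound b).2; rewrite ltnNge -q8 qt.
by rewrite !z_count subrr normr0 ltW.
Qed.
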